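(* Let $n$ be a positive integer. If $A\subseteq Q_n$ is a Hadamard simplex, then $A\in F'\bigl(n;\tfrac{n+1}{2}\bigr)$; that is, $A$ is a rigid facet of the Vietoris--Rips complex $\mathcal{VR}\bigl(Q_n;\tfrac{n+1}{2}\bigr)$.
   Context: $Q_n=\{\pm1\}^n$ is equipped with the Hamming distance $d$, where $d(x,y)$ is the number of coordinates in which $x$ and $y$ differ. For a metric space $(X,\rho)$ and $r\ge 0$, the Vietoris--Rips complex $\mathcal{VR}(X;r)$ is the simplicial complex with vertex set $X$ whose simplices are the finite nonempty subsets $\sigma\subseteq X$ with $\rho(x,y)\le r$ for all $x,y\in\sigma$. A facet is a simplex that is maximal under inclusion. A simplex $\sigma\in\mathcal{VR}(Q_n;r)$ is rigid if $\max_{y\in\sigma}d(x,y)=r$ for every $x\in\sigma$. $F'(n;r)$ denotes the set of all rigid facets of $\mathcal{VR}(Q_n;r)$. A subset $A\subseteq Q_n$ is a Hadamard simplex if $|A|=n+1$ and $\langle x,y\rangle=-1$ for all $x,y\in A$ with $x\ne y$, where $\langle\cdot,\cdot\rangle$ is the standard Euclidean inner product on $\mathbb{R}^n$. *)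

(* Defs.v *)
From HB Require Import structures.
From mathcomp Require Import all_boot all_order all_algebra.
From mathcomp Require Import finmap.
From mathcomp Require Import classical_sets reals topology.

Set Implicit Arguments.
Unset Strict Implicit.
Unset Printing Implicit Defensive.
Set Warnings "-redundant-canonical-projection".

Import Order.TTheory GRing.Theory Num.Theory.

Local Open Scope classical_set_scope.
Local Open Scope ring_scope.

Section Rips.
Variables (R : realType) (X : metricType R).

(* A simplicial complex is given by its set of (nonempty) simplices. *)
Definition rips (r : R) : set {fset X} :=
  [set s | s != fset0 /\ {in s &, forall x y, mdist x y <= r}].

Definition facet (K : set {fset X}) (s : {fset X}) : Prop :=
  K s /\ forall t : {fset X}, K t -> fsubset s t -> t = s.

(* The default value 0 of the maximum is harmless: it is only taken over
   nonempty s, and distances are nonnegative. *)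
Definition rigid (r : R) (s : {fset X}) : Prop :=
  {in s, forall x, \big[Num.max/0]_(y <- s) mdist x y = r}.

End Rips.

Section Cube.
Variables (R : realType) (n : nat).

Record cube := Cube {
  cube_val :> 'rV[R]_n ;
  cube_valP : [forall i, (cube_val 0 i == 1) || (cube_val 0 i == -1)] }.

HB.instance Definition _ := [isSub for cube_val].
HB.instance Definition _ := [Choice of cube by <:].

Definition hamming (x y : cube) : R := #|[set i | x 0 i != y 0 i]%SET|%:R.

Fact hammingxx x : hamming x x = 0.
Proof.
by apply/eqP; rewrite pnatr_eq0 cards_eq0; apply/eqP/setP => i; rewrite !inE eqxx.
Qed.

Fact hamming_eq0 x y : hamming x y = 0 -> x = y.
Proof.
move/eqP; rewrite pnatr_eq0 cards_eq0 => /eqP/setP h.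
apply/val_inj/rowP => i; have := h i; rewrite !inE.
by move/negbT; rewrite negbK => /eqP.
Qed.

Fact hammingC x y : hamming x y = hamming y x.
Proof.
by congr (_%:R); apply: eq_card => i; rewrite !inE eq_sym.
Qed.

Fact hamming_triangle y x z : hamming x z <= hamming x y + hamming y z.
Proof.
rewrite -natrD ler_nat; apply: leq_trans (leq_card_setU _ _).
apply/subset_leq_card/fintype.subsetP => i; rewrite !inE -negb_and.
by apply: contra => /andP[/eqP -> /eqP ->].
Qed.

HB.instance Definition _ :=
  isMetric.Build R cube hammingxx hamming_eq0 hammingC hamming_triangle.

Fact mdist_cubeE (x y : cube) : mdist x y = hamming x y.
Proof. by []. Qed.

Definition inner (x y : 'rV[R]_n) : R := \sum_i x 0 i * y 0 i.

Definition hadamard_simplex (A : {fset cube}) : Prop :=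
  #|` A| = n.+1 /\ {in A &, forall x y : cube, x != y -> inner x y = -1}.

Definition rigid_facets (r : R) : set {fset cube} :=
  [set s | facet (rips r) s /\ rigid r s].

End Cube.

Arguments rigid_facets {R} n r.

(* Main.v *)
Require Import Defs.
From mathcomp Require Import all_boot all_order all_algebra.
From mathcomp Require Import finmap.
From mathcomp Require Import classical_sets reals topology.
From mathcomp Require Import ring lra.

(** On the cube, [inner x y = n - 2 * hamming x y]; hence two distinct points
    of a Hadamard simplex [A] are at distance exactly [(n + 1) / 2], and [A] is
    a rigid simplex.

    For maximality, prepend a coordinate [1] to every [x] in [A]. The result is
    a square matrix of size [n + 1] with orthogonal rows of squared norm
    [n + 1]; its columns are then orthogonal too, which is the Parseval identity
    [hadamard_parseval]. Let [z] be a point of the cube within distance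
    [(n + 1) / 2] of all of [A], and put [b x := 1 + inner z x], so that
    [0 <= b x <= n + 1]. Parseval gives both [\sum_x b x = n + 1] and
    [\sum_x b x ^+ 2 = (n + 1) ^+ 2], so the nonnegative numbers
    [b x * (n + 1 - b x)] add up to [0] and each of them vanishes. As the [b x]
    are not all [0], some [b x] equals [n + 1], that is [hamming z x = 0], and
    [z = x] belongs to [A]. *)

Import Order.TTheory GRing.Theory Num.Theory.

Local Open Scope classical_set_scope.
Local Open Scope ring_scope.

Lemma inner_hamming {R : realType} {n : nat} (x y : cube R n) :
  inner x y = n%:R - 2 * hamming x y.
Proof.
have coordE i : x 0 i * y 0 i = 1 - 2 * (x 0 i != y 0 i)%:R.
  have sgn (u : cube R n) : (u 0 i == 1) || (u 0 i == -1).
    exact: (forallP (cube_valP u)).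
  have N11 : (-1 == 1 :> R) = false by apply/negbTE/eqP; lra.
  case/orP: (sgn x) => /eqP ->; case/orP: (sgn y) => /eqP ->;
    by rewrite ?eqxx ?N11 1?eq_sym ?N11 /=; ring.
rewrite /inner (eq_bigr _ (fun i _ => coordE i)) sumrB -mulr_sumr.
rewrite sumr_const card_ord /hamming -sum1_card natr_sum [in RHS]big_mkcond /=.
by congr (_ - 2 * _); apply: eq_bigr => i _; rewrite inE; case: (_ != _).
Qed.

Lemma innerxx {R : realType} {n : nat} (x : cube R n) : inner x x = n%:R.
Proof. by rewrite inner_hamming hammingxx mulr0 subr0. Qed.

Lemma hadamard_mdist {R : realType} {n : nat} {A : {fset cube R n}} :
  hadamard_simplex A ->
  {in A &, forall x y, x != y -> mdist x y = (n%:R + 1) / 2}.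
Proof.
move=> [_ hA] x y xA yA xy; have := hA x y xA yA xy.
rewrite mdist_cubeE inner_hamming; lra.
Qed.

(** The homogenization of a vector. The inner product of two homogenizations
    is one more than that of the vectors, so it vanishes exactly when the
    inner product of the vectors is [-1]. *)
Definition lift1 {R : realType} {n : nat} (u : 'rV[R]_n) : 'rV[R]_(1 + n) :=
  row_mx 1%:M u.

Lemma mul_lift1 {R : realType} {n : nat} (u v : 'rV[R]_n) :
  lift1 u *m (lift1 v)^T = (1 + inner u v)%:M.
Proof.
rewrite tr_row_mx mul_row_col trmx1 mulmx1 raddfD /=; congr (_ + _).
rewrite [LHS]mx11_scalar mxE /inner; congr _%:M.
by apply: eq_bigr => i _; rewrite mxE.
Qed.

(** The matrix [H] of homogenized points satisfies [H *m H^T = n.+1%:R%:M];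
    it is square, so [H^T *m H = n.+1%:R%:M] as well, and the identity is the
    resulting equality between bilinear forms. *)
Lemma hadamard_parseval {R : realType} {n : nat} {A : {fset cube R n}} :
  hadamard_simplex A -> forall u v : 'rV[R]_n,
  \sum_(x <- A) (1 + inner u x) * (1 + inner v x)
    = n.+1%:R * (1 + inner u v).
Proof.
move=> [cardA hA] u v.
have [x0 _] : exists x, x \in A by apply/fset0Pn; rewrite -cardfs_gt0 cardA.
pose p (i : 'I_(1 + n)) := nth x0 A i.
have pA i : p i \in A by rewrite /p mem_nth // cardA.
pose H : 'M[R]_(1 + n) := \matrix_i lift1 (p i).
have N0 : n.+1%:R != 0 :> R by rewrite pnatr_eq0.
have HHT : H *m H^T = n.+1%:R%:M.
  apply/matrixP => i j.
  have -> : (H *m H^T) i j = (lift1 (p i) *m (lift1 (p j))^T) 0 0.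
    by rewrite !mxE; apply: eq_bigr => k _; rewrite !mxE.
  rewrite mul_lift1 !mxE eqxx mulr1n; have [->|ij] := eqVneq i j.
    by rewrite innerxx mulr1n -natr1 addrC.
  rewrite hA ?pA ?subrr //; apply: contra ij.
  by rewrite /p nth_uniq ?fset_uniq ?cardA.
have HTH : H^T *m H = n.+1%:R%:M.
  have : H *m (n.+1%:R^-1 *: H^T) = 1%:M.
    by rewrite -scalemxAr HHT scale_scalar_mx mulVf.
  move/mulmx1C; rewrite -scalemxAl => /(congr1 (GRing.scale n.+1%:R)).
  by rewrite scalerA mulfV // scale1r scale_scalar_mx mulr1.
have coordE w i : (lift1 w *m H^T) 0 i = 1 + inner w (p i).
  have := congr1 (fun M : 'M_1 => M 0 0) (mul_lift1 w (p i)).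
  rewrite !mxE eqxx mulr1n => <-.
  by apply: eq_bigr => k _; rewrite !mxE.
have : (lift1 u *m H^T) *m (lift1 v *m H^T)^T
       = (n.+1%:R * (1 + inner u v))%:M.
  rewrite trmx_mul trmxK mulmxA -(mulmxA _ H^T) HTH mul_mx_scalar.
  by rewrite -scalemxAl mul_lift1 scale_scalar_mx.
move/(congr1 (fun M : 'M_1 => M 0 0)); rewrite mxE [RHS]mxE eqxx mulr1n => <-.
rewrite (big_nth x0) cardA big_mkord.
by apply: eq_bigr => i _; rewrite [X in _ = _ * X]mxE !coordE.
Qed.

Lemma hadamard_maximal {R : realType} {n : nat} {A : {fset cube R n}} :
  hadamard_simplex A -> forall z : cube R n,
  {in A, forall x, mdist z x <= (n%:R + 1) / 2} -> z \in A.
Proof.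
move=> hA z zA; pose b (x : cube R n) : R := 1 + inner z x.
have sumb : \sum_(x <- A) b x = n.+1%:R.
  (* Parseval against the zero vector, whose homogenization only sees the
     prepended coordinate. *)
  have inner0 w : inner w (0 : 'rV[R]_n) = 0 /\ inner (0 : 'rV[R]_n) w = 0.
    by split; apply: big1 => i _; rewrite mxE ?mulr0 ?mul0r.
  have := hadamard_parseval hA z 0.
  rewrite (inner0 z).1 addr0 mulr1 => <-.
  by apply: eq_bigr => x _; rewrite (inner0 _).2 addr0 mulr1.
have sumb2 : \sum_(x <- A) b x * b x = n.+1%:R * n.+1%:R.
  by rewrite hadamard_parseval // innerxx [1 + _]addrC natr1.
have sum0 : \sum_(x <- A) b x * (n.+1%:R - b x) = 0.
  under eq_bigr => x _ do rewrite mulrBr.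
  by rewrite sumrB -mulr_suml sumb sumb2 subrr.
have b_ge0 x : x \in A -> 0 <= b x.
  move=> /zA; rewrite mdist_cubeE /b inner_hamming; lra.
have b_le x : b x <= n.+1%:R.
  have : 0 <= hamming z x by exact: ler0n.
  rewrite /b inner_hamming -natr1; lra.
have b_ext x : x \in A -> b x * (n.+1%:R - b x) = 0.
  move=> xA; move: sum0; rewrite (big_fsetD1 x) //= => /eqP.
  rewrite paddr_eq0 => [/andP[/eqP //]||].
    by rewrite mulr_ge0 ?b_ge0 ?subr_ge0.
  rewrite big_seq; apply: sumr_ge0 => y; rewrite !inE => /andP[_ yA].
  by rewrite mulr_ge0 ?b_ge0 ?subr_ge0.
have [/hasP[x xA bx]|/hasPn b0] := boolP (has (fun x => b x != 0) A).
  move/eqP: (b_ext x xA); rewrite mulf_eq0 (negbTE bx) /= => /eqP.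
  rewrite /b inner_hamming -natr1 => bxE.
  by have -> : z = x; first by apply: hamming_eq0; lra.
move/eqP: sumb; rewrite big_seq big1 => [|x /b0]; last by rewrite negbK => /eqP.
by rewrite eq_sym pnatr_eq0.
Qed.

Lemma hadamard_rigid {R : realType} {n : nat} {A : {fset cube R n}} :
  (0 < n)%N -> hadamard_simplex A -> rigid ((n%:R + 1) / 2) A.
Proof.
move=> n_gt0 hA x xA.
have r_ge0 : 0 <= (n%:R + 1) / 2 :> R by rewrite divr_ge0 ?addr_ge0 ?ler0n.
have [y] : exists y, y \in (A `\ x)%fset.
  apply/fset0Pn; rewrite -cardfs_gt0.
  by move: (cardfsD1 x A); rewrite xA hA.1 add1n => -[<-].
rewrite !inE => /andP[yx yA]; apply/le_anti/andP; split.
  rewrite big_seq; apply: bigmax_le => // w wA.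
  have [->|xw] := eqVneq x w; first by rewrite mdist_cubeE hammingxx.
  by rewrite (hadamard_mdist hA).
rewrite -(hadamard_mdist hA x y) ?[x == y]eq_sym //.
exact: le_bigmax_seq.
Qed.

Theorem theorem4 (R : realType) (n : nat) (n_gt0 : (0 < n)%N)
    (A : {fset cube R n}) (hA : hadamard_simplex A) :
  rigid_facets n ((n%:R + 1) / 2) A.
Proof.
split; last exact: hadamard_rigid.
split=> [|t [_ tr] At].
  split=> [|x y xA yA]; first by rewrite -cardfs_gt0 hA.1.
  have [->|xy] := eqVneq x y; last by rewrite (hadamard_mdist hA).
  by rewrite mdist_cubeE hammingxx divr_ge0 ?addr_ge0 ?ler0n.
apply/eqP; rewrite eqEfsubset At andbT; apply/fsubsetP => z zt.
apply: hadamard_maximal => // x xA; apply: tr => //.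
exact: (fsubsetP At).
Qed.
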